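(* Let $1\le q\le 2$, let $h_q=2^q-2$, and let $(X,d)$ be a metric space. Suppose a zero-sum coefficient vector has exactly one positive coefficient and $r\ge 2$ negative coefficients. If \[ h_q\le \frac{2}{r-1}, \] then its $q$-negative-type inequality holds. Equivalently, the $q$-negative-type inequality holds for every such sign pattern (one positive and $r$ negative coefficients) for $q\le \log_2\frac{2r}{r-1}$ (with $1\le q\le 2$). The exponent $\log_2\frac{2r}{r-1}$ is sharp on the equal-edge $r$-leaf star (the metric with a center at distance $1$ from each of $r$ leaves, and distance $2$ between distinct leaves).
   Context: A zero-sum coefficient vector is a finitely supported real vector $c=(c_x)_{x\in X}$ with $\sum_x c_x=0$. Its $q$-negative-type inequality in $(X,d)$ is $\sum_{x,y}c_xc_y\,d(x,y)^q\le 0$. Sharpness on a metric means that for every larger exponent the inequality fails on that metric for some zero-sum vector of the stated sign pattern. *)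

(* Defs.v *)
From HB Require Import structures.
From mathcomp Require Import all_boot all_order all_algebra finmap.
From mathcomp Require Import all_classical all_reals all_analysis.
From mathcomp Require Import lra.

Set Implicit Arguments.
Unset Strict Implicit.
Unset Printing Implicit Defensive.
Import Order.TTheory GRing.Theory Num.Theory.
Local Open Scope fset_scope.
Local Open Scope ring_scope.

Definition zero_sum (R : realType) (X : metricType R)
    (c : {fsfun X -> R with 0}) : Prop :=
  \sum_(x <- finsupp c) c x = 0.

(* Diagonal terms vanish only for q != 0, because [0 `^ 0 = 1]. *)
Definition negative_type_ineq (R : realType) (X : metricType R) (q : R)
    (c : {fsfun X -> R with 0}) : Prop :=
  \sum_(x <- finsupp c) \sum_(y <- finsupp c) c x * c y * mdist x y `^ q <= 0.

Definition has_sign_pattern (R : realType) (X : metricType R) (m n : nat)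
    (c : {fsfun X -> R with 0}) : Prop :=
  #|` [fset x in finsupp c | 0 < c x]| = m /\
  #|` [fset x in finsupp c | c x < 0]| = n.

Definition sharp_exponent (R : realType) (X : metricType R) (m n : nat)
    (q0 : R) : Prop :=
  forall q : R, q0 < q ->
    exists c : {fsfun X -> R with 0},
      [/\ zero_sum c, has_sign_pattern m n c & ~ negative_type_ineq q c].

Definition log2 (R : realType) (x : R) : R := ln x / ln 2.

(* [None] is the center and [Some i] are the leaves; [R] is a phantom parameter
   that determines the field of values of the metric. *)
Definition star (R : realType) (r : nat) : Type := option 'I_r.

HB.instance Definition _ (R : realType) (r : nat) :=
  Choice.copy (star R r) (option 'I_r).

Definition star_dist (R : realType) (r : nat) (x y : star R r) : R :=
  match x, y with
  | None, None => 0
  | Some i, Some j => if i == j then 0 else 2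
  | _, _ => 1
  end.

Section StarMetric.
Context (R : realType) (r : nat).
Implicit Types x y z : star R r.

Lemma star_distxx x : star_dist x x = 0.
Proof. by case: x => [i|] //=; rewrite eqxx. Qed.

Lemma star_dist_eq0 x y : star_dist x y = 0 -> x = y.
Proof.
case: x y => [i|] [j|] //=; [|by move=> /eqP; rewrite oner_eq0..].
by case: eqP => [->//|_] /eqP; rewrite pnatr_eq0.
Qed.

Lemma star_dist_sym x y : star_dist x y = star_dist y x.
Proof. by case: x y => [i|] [j|] //=; rewrite eq_sym. Qed.

Lemma star_dist_triangle y x z :
  star_dist x z <= star_dist x y + star_dist y z.
Proof.
case: x y z => [i|] [j|] [k|] //=; try (by repeat case: ifP => ? ; lra).
have [->|nij] := eqVneq i j; first by rewrite add0r.
by case: ifP => _; case: ifP => _; lra.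
Qed.

HB.instance Definition _ := isMetric.Build R (star R r)
  star_distxx star_dist_eq0 star_dist_sym star_dist_triangle.

End StarMetric.

(* Main.v *)
(* The two-point inequality
     (a + b)^q <= a^q + b^q + h_q (a b)^(q/2)   for 1 <= q <= 2
   drives everything.  With a = e^(m+t), b = e^(m-t) it reads
   (2 cosh t)^q <= 2 cosh (q t) + h_q, an equality at t = 0, and differentiation
   in t reduces it to sinh (2t)^(q-1) sinh (t)^(2-q) <= sinh (q t), the
   log-concavity of sinh.
   Let p carry the positive coefficient, m_i > 0 be the absolute values of the
   negative coefficients, at distance a_i from p, and u_i = a_i^(q/2).  Bounding
   d(x_i, x_j) by a_i + a_j and using the two-point inequality, the quadratic
   form is at most h_q (sum m_i u_i)^2 - (2 + h_q) sum (m_i u_i)^2, and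
   Cauchy-Schwarz makes this nonpositive as soon as r h_q <= 2 + h_q.  On the
   star all these steps are equalities at the coefficients (r, -1, ..., -1). *)
Require Import Defs.
From mathcomp Require Import all_boot all_order all_algebra finmap.
From mathcomp Require Import all_classical all_reals all_analysis.
From mathcomp Require Import ring lra.
Set Implicit Arguments.
Unset Strict Implicit.
Unset Printing Implicit Defensive.
Import Order.TTheory GRing.Theory Num.Theory.
Import numFieldNormedType.Exports.
Local Open Scope ring_scope.

(** * Exponential and power inequalities leading to the two-point bound *)

Lemma weighted_amgm (R : realType) (p u v : R) : 0 <= p <= 1 ->
  0 < u -> 0 < v -> u `^ (1 - p) * v `^ p <= (1 - p) * u + p * v.
Proof.
move=> /andP[p0 p1] u0 v0.
have := @convex_expR R (Itv01 p0 p1) (ln v) (ln u).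
rewrite !convRE /= /unstable.onem !lnK ?posrE// addrC expRD [leRHS]addrC.
by rewrite /powR !gt_eqF.
Qed.

(* The two-term Hoelder inequality for the splittings
   1 = (1 - y) + y and 1 = (1 - y ^ 2) + y ^ 2. *)
Lemma onem_powR_ge (R : realType) (p y : R) : 0 <= p <= 1 -> 0 < y < 1 ->
  (1 - y) * (1 + y) `^ p <= 1 - y `^ (1 + p).
Proof.
move=> p01 /andP[y0 y1].
have ny : 0 < 1 - y by lra.
have py : 0 < 1 + y by lra.
have := weighted_amgm p01 ny (mulr_gt0 ny py).
have := weighted_amgm p01 y0 (mulr_gt0 y0 y0).
rewrite !powRM; [|lra..].
rewrite !mulrA -!powRD ?(gt_eqF y0) ?(gt_eqF ny) ?implybT//.
rewrite (_ : 1 - p + p + p = 1 + p); last by ring.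
rewrite (_ : 1 - p + p = 1); last by ring.
rewrite powRr1; last lra.
by move=> ? ?; nra.
Qed.

(** With [y = expR (- t) ^+ 2], both sides are [expR (q * t)] times the sides of [onem_powR_ge] at
    [p = q - 1]. The left side is the sinh product of the overview, after expanding sinh (2t) = 2
    sinh t cosh t. *)
Lemma sinh_powR_le (R : realType) (q t : R) : 1 <= q <= 2 -> 0 < t ->
  (expR t - expR (- t)) * (expR t + expR (- t)) `^ (q - 1)
  <= expR (q * t) - expR (- (q * t)).
Proof.
move=> q12 t0; pose y := expR (- t) * expR (- t).
have e0 : 0 < expR t := expR_gt0 _.
have y0 : 0 < y by rewrite mulr_gt0 ?expR_gt0.
have y01 : 0 < y < 1 by rewrite y0 /y -expRD expR_lt1; lra.
have p01 : 0 <= q - 1 <= 1 by lra.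
have tK : expR t * expR (- t) = 1 by rewrite -expRD subrr expR0.
have tyE : expR t * y = expR (- t) by rewrite /y mulrA tK mul1r.
have := onem_powR_ge p01 y01; rewrite -(ler_pM2l (expR_gt0 (q * t))).
have -> : 1 + (q - 1) = q by ring.
have -> : y `^ q = expR (- (q * t) - q * t).
  by rewrite /powR gt_eqF// /y -expRD expRK; congr expR; ring.
rewrite [X in _ <= X -> _]mulrBr mulr1 -expRD addrCA subrr addr0.
have -> : expR t + expR (- t) = expR t * (1 + y) by rewrite mulrDr mulr1 tyE.
have -> : expR t - expR (- t) = expR t * (1 - y) by rewrite mulrBr mulr1 tyE.
have -> : expR (q * t) = expR t * expR t `^ (q - 1).
  by rewrite /powR gt_eqF// expRK -expRD; congr expR; ring.
rewrite powRM ?(ltW e0)//; last by rewrite addr_ge0 ?ltW.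
by rewrite mulrACA.
Qed.

Lemma cosh_powR_le (R : realType) (q t : R) : 1 <= q <= 2 -> 0 <= t ->
  (expR t + expR (- t)) `^ q <= expR (q * t) + expR (- (q * t)) + (2 `^ q - 2).
Proof.
move=> q12 t0.
pose w (s : R) := expR s + expR (- s).
have w0 s : 0 < w s by rewrite addr_gt0 ?expR_gt0.
pose f (s : R) := expR (q * s) + expR (- (q * s)) - expR (q * ln (w s)).
have df (s : R) : is_derive s (1 : R) f
    (q * (expR (q * s) - expR (- (q * s))
          - (expR s - expR (- s)) * w s `^ (q - 1))).
  have dw : is_derive s (1 : R) w (expR s - expR (- s)).
    apply: is_derive_eq; rewrite /GRing.scale /=; ring.
  have dl := is_derive1_comp (is_derive1_ln (w0 s)) dw.
  apply: is_derive_eq; rewrite /GRing.scale /=.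
  have -> : w s `^ (q - 1) = expR (q * ln (w s)) * (w s)^-1.
    by rewrite powRB ?(gt_eqF (w0 s)) ?implybT//
      (powRr1 (ltW (w0 s))) /powR (gt_eqF (w0 s)).
  by ring.
have f0 : f 0 <= f t.
  apply: (@ger0_derive1_ndecry R f 0) => //.
  - move=> s; rewrite in_itv/= andbT => s0; rewrite derive1E.
    have [_ ->] := df s; apply: mulr_ge0; first lra.
    by rewrite subr_ge0; exact: sinh_powR_le.
  - apply: continuous_subspaceT => s.
    by apply/differentiable_continuous/derivable1_diffP; have [] := df s.
move: f0; rewrite /f /w mulr0 oppr0 expR0.
rewrite (_ : (expR t + expR (- t)) `^ q = expR (q * ln (w t))); last first.
  by rewrite /powR (gt_eqF (w0 t)).
rewrite (_ : 2 `^ q = expR (q * ln (1 + 1))); last by rewrite /powR gt_eqF.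
by rewrite /w; lra.
Qed.

Lemma powRD_le (R : realType) (q a b : R) : 1 <= q <= 2 -> 0 <= a -> 0 <= b ->
  (a + b) `^ q
  <= a `^ q + b `^ q + (2 `^ q - 2) * (a `^ (q / 2) * b `^ (q / 2)).
Proof.
move=> q12; have q0 : q != 0 by lra.
have q20 : q / 2 != 0 by lra.
rewrite [0 <= a]le_eqVlt => /predU1P[<- _|a0].
  by rewrite add0r !powR0// add0r mul0r mulr0 addr0.
rewrite le_eqVlt => /predU1P[<-|b0].
  by rewrite addr0 !powR0// mulr0 mulr0 !addr0.
(* By symmetry; the order makes [t] below nonnegative, as [cosh_powR_le] demands. *)
wlog ba : a b a0 b0 / b <= a => [H|].
  have [|/ltW] := leP b a; first exact: H.
  by move=> /(H b a b0 a0); rewrite addrC [b `^ q + _]addrC [b `^ _ * _]mulrC.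
pose t := (ln a - ln b) / 2; pose m := (ln a + ln b) / 2.
have t0 : 0 <= t by rewrite /t divr_ge0// subr_ge0 ler_ln.
have aE : a = expR m * expR t.
  by rewrite -expRD -[LHS]lnK//; congr expR; rewrite /m /t; field.
have bE : b = expR m * expR (- t).
  by rewrite -expRD -[LHS]lnK//; congr expR; rewrite /m /t; field.
have eE x r : expR x `^ r = expR (r * x) :> R.
  by rewrite /powR gt_eqF ?expR_gt0// expRK.
rewrite -powRM ?(ltW a0) ?(ltW b0)// {1}aE {1}bE -mulrDr.
rewrite [leLHS]powRM ?addr_ge0 ?expR_ge0//.
have -> : (a * b) `^ (q / 2) = expR m `^ q.
  by rewrite aE bE mulrACA -!expRD !eE; congr expR; field.
rewrite aE bE !(powRM _ (expR_ge0 _) (expR_ge0 _)).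
rewrite [X in _ <= _ + X]mulrC -!mulrDr ler_pM2l ?powR_gt0 ?expR_gt0//.
by rewrite !(eE t) !(eE (- t)) mulrN; exact: cosh_powR_le.
Qed.

(** * The quadratic form with one positive coefficient *)

Lemma sqr_sum_le (R : realFieldType) (I : Type) (s : seq I) (v : I -> R) :
  (\sum_(i <- s) v i) ^+ 2 <= (size s)%:R * \sum_(i <- s) v i ^+ 2.
Proof.
elim: s => [|i s IHs]; first by rewrite !big_nil expr0n mulr0.
rewrite !big_cons /= -natr1.
(* This sum is exactly the increase of right side minus left side when [v i] joins the list. *)
have : 0 <= \sum_(j <- s) (v j - v i) ^+ 2.
  by apply: sumr_ge0 => j _; exact: sqr_ge0.
have -> : \sum_(j <- s) (v j - v i) ^+ 2 =
    \sum_(j <- s) v j ^+ 2 - 2 * v i * \sum_(j <- s) v j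
    + (size s)%:R * v i ^+ 2.
  rewrite mulr_sumr -sumrB.
  rewrite (eq_bigr (fun j => v j ^+ 2 - 2 * v i * v j + v i ^+ 2)); last first.
    by move=> j _; ring.
  by rewrite big_split /= big_const_seq count_predT iter_addr_0
    (mulr_natl (v i ^+ 2)).
move: IHs; set S := \sum_(j <- s) _; set T := \sum_(j <- s) _ => ? ?.
nra.
Qed.

Lemma double_sum_center_le (R : realType) (X : metricType R) (q : R) (p : X)
    (s : seq X) (c : X -> R) :
  1 <= q <= 2 -> uniq s -> (forall x, x \in s -> c x <= 0) ->
  c p = - \sum_(x <- s) c x -> (2 `^ q - 2) * ((size s)%:R - 1) <= 2 ->
  \sum_(x <- p :: s) \sum_(y <- p :: s) c x * c y * mdist x y `^ q <= 0.
Proof.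
move=> q12 us c_le0 cp hq; have q0 : q != 0 by lra.
set h := 2 `^ q - 2.
have h_ge0 : 0 <= h.
  rewrite /h subr_ge0 -[leLHS]powRr1; last lra.
  by apply: ler_powR; lra.
pose u x := mdist p x `^ (q / 2).
have uE x : mdist p x `^ q = u x ^+ 2.
  by rewrite /u -powR_mulrn ?powR_ge0// -powRrM; congr powR; field.
pose A := \sum_(x <- s) c x; pose B := \sum_(x <- s) c x * u x ^+ 2.
pose C := \sum_(x <- s) c x * u x; pose D := \sum_(x <- s) (c x * u x) ^+ 2.
(* The two-point bound is summed over all pairs. On the diagonal it gives
   [(2 + h) * (c x * u x) ^+ 2] where the true entry is 0, hence the subtracted term. *)
have leaves : \sum_(x <- s) \sum_(y <- s) c x * c y * mdist x y `^ q <=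
    \sum_(x <- s) (c x * u x ^+ 2 * A + c x * B + h * (c x * u x) * C
                   - (2 + h) * (c x * u x) ^+ 2).
  rewrite !big_seq; apply: ler_sum => x xs.
  have -> : c x * u x ^+ 2 * A + c x * B + h * (c x * u x) * C
      - (2 + h) * (c x * u x) ^+ 2 =
      \sum_(y <- s) (c x * c y * (u x ^+ 2 + u y ^+ 2 + h * (u x * u y))
        - (if y == x then (2 + h) * (c x * u x) ^+ 2 else 0)).
    rewrite sumrB -big_mkcond -big_filter filter_pred1_uniq// big_seq1.
    congr (_ - _); rewrite /A /B /C !mulr_sumr -!big_split /=.
    by apply: eq_bigr => y _; ring.
  rewrite !big_seq; apply: ler_sum => y ys.
  have [->|nyx] := eqVneq y x.
    by rewrite mdistxx powR0// mulr0 le_eqVlt; apply/orP; left; apply/eqP; ring.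
  (* Two nonpositive coefficients have a nonnegative product, so an upper bound on the distance
     suffices. *)
  rewrite subr0 ler_wpM2l//; first by rewrite mulr_le0 ?c_le0.
  have := powRD_le q12 (mdist_ge0 p x) (mdist_ge0 p y).
  rewrite -!/(u _) !uE; apply: le_trans.
  apply: ge0_ler_powR; rewrite ?nnegrE ?addr_ge0 ?mdist_ge0//; first lra.
  by rewrite (metric_sym p x) metric_triangle.
rewrite big_cons big_cons mdistxx powR0// mulr0 add0r.
under [X in _ + X]eq_bigr do rewrite big_cons.
rewrite big_split /= addrA.
(* Since [c p = - A], the row and column of [p] contribute [- 2 * A * B] in total, cancelling the
   [A * B] terms of [leaves]. *)
have -> : \sum_(y <- s) c p * c y * mdist p y `^ q = - A * B.
  by rewrite /B mulr_sumr; apply: eq_bigr => y _; rewrite uE cp [RHS]mulrA.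
have -> : \sum_(x <- s) c x * c p * mdist x p `^ q = - A * B.
  rewrite /B mulr_sumr; apply: eq_bigr => y _.
  by rewrite metric_sym uE cp [RHS]mulrA [c y * _]mulrC.
have := sqr_sum_le s (fun x => c x * u x); rewrite -/C -/D => CS.
have D0 : 0 <= D by apply: sumr_ge0 => x _; exact: sqr_ge0.
move: leaves; rewrite sumrB !big_split /=.
rewrite -!mulr_suml -!mulr_sumr -/A -/B -/C -/D => leaves.
(* With n the size of [s], the hypothesis [hq] rearranges to n h <= 2 + h. *)
have : h * C ^+ 2 <= (2 + h) * D.
  apply: (le_trans (ler_wpM2l h_ge0 CS)); rewrite mulrA ler_wpM2r//.
  by move: hq; rewrite -/h; lra.
by move: leaves; set L := \sum_(x <- s) _; lra.
Qed.

(** Puts the sign pattern in the list form of [double_sum_center_le]; the list exhausts the support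
    because coefficients there are nonzero. *)
Lemma one_positive_finsupp (R : realType) (X : metricType R) (r : nat)
    (c : {fsfun X -> R with 0}) : has_sign_pattern 1 r c ->
  exists p, exists s : seq X, [/\ perm_eq (finsupp c) (p :: s), size s = r,
    uniq s & forall x, x \in s -> c x < 0].
Proof.
case=> /eqP/cardfs1P[p Ep] Er.
exists p, (enum_fset [fset x in finsupp c | c x < 0]%fset); split => //.
- apply: uniq_perm => //=.
    rewrite fset_uniq andbT !inE /=.
    have : p \in [fset x in finsupp c | 0 < c x]%fset by rewrite Ep inE.
    by rewrite !inE => /andP[_ /ltW]; rewrite leNgt => /negPf->; rewrite andbF.
  move=> x; rewrite inE.
  have -> : (x == p) = (x \in [fset x in finsupp c | 0 < c x]%fset).
    by rewrite Ep inE.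
  rewrite !inE /= -andb_orr; case: (boolP (x \in finsupp c)) => //=.
  by rewrite mem_finsupp => /lt_total; rewrite orbC.
- exact: fset_uniq.
- by move=> x; rewrite !inE => /andP[].
Qed.

Lemma negative_type_one_positive (R : realType) (X : metricType R) (r : nat)
    (q : R) (c : {fsfun X -> R with 0}) :
  1 <= q <= 2 -> zero_sum c -> has_sign_pattern 1 r c ->
  (2 `^ q - 2) * (r%:R - 1) <= 2 -> negative_type_ineq q c.
Proof.
move=> q12 c0 /one_positive_finsupp[p [s [ps <- us s_lt0]]] hq.
rewrite /negative_type_ineq (perm_big _ ps).
under eq_bigr do rewrite (perm_big _ ps).
apply: double_sum_center_le => // [x /s_lt0/ltW//|].
move: c0; rewrite /zero_sum (perm_big _ ps) big_cons => /eqP.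
by rewrite addr_eq0 => /eqP.
Qed.

(** * The logarithmic threshold and its sharpness on the star *)

Lemma ler_log2 (R : realType) (q x : R) : 0 < x ->
  (q <= log2 x) = (2 `^ q <= x).
Proof.
move=> x0; have l2 : 0 < ln 2 :> R by rewrite ln_gt0// ltr1n.
by rewrite /log2 ler_pdivlMr// -ln_powR ler_ln ?posrE ?powR_gt0.
Qed.

Section StarSharpness.
Context (R : realType) (r : nat) (r_gt0 : (0 < r)%N).

Definition star_points : seq (star R r) := None :: map Some (enum 'I_r).

Definition star_coef (x : star R r) : R := if x is None then r%:R else -1.

Definition star_fsfun : {fsfun star R r -> R with 0} :=
  [fsfun x in seq_fset tt star_points => star_coef x].

Let uniq_points : uniq star_points.
Proof.
rewrite /= map_inj_uniq ?enum_uniq ?andbT; last by move=> ? ? [].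
by apply/mapP => -[].
Qed.

Let mem_points (x : star R r) : x \in star_points.
Proof.
case: x => [i|]; rewrite in_cons ?eqxx//=.
by apply: map_f; rewrite mem_enum.
Qed.

Lemma star_fsfunE x : star_fsfun x = star_coef x.
Proof. by rewrite fsfun_fun seq_fsetE mem_points. Qed.

Lemma finsupp_star : perm_eq (finsupp star_fsfun) star_points.
Proof.
apply: uniq_perm => // x; rewrite mem_points mem_finsupp star_fsfunE.
by case: x => [i|] /=; rewrite ?oppr_eq0 ?oner_eq0// pnatr_eq0 -lt0n.
Qed.

Lemma sum_star (F : star R r -> R) :
  \sum_(x <- finsupp star_fsfun) F x = F None + \sum_(i < r) F (Some i).
Proof. by rewrite (perm_big _ finsupp_star) big_cons big_map big_enum. Qed.

Lemma zero_sum_star : zero_sum star_fsfun.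
Proof.
rewrite /zero_sum sum_star star_fsfunE.
under eq_bigr do rewrite star_fsfunE.
by rewrite sumr_const card_ord mulNrn subrr.
Qed.

Lemma star_sign_pattern : has_sign_pattern 1 r star_fsfun.
Proof.
have count_star (P : pred (star R r)) :
    #|` [fset x in finsupp star_fsfun | P x]%fset| = count P star_points.
  rewrite -size_filter; apply: perm_size; apply: uniq_perm => //.
    exact: filter_uniq.
  move=> x; rewrite mem_filter mem_points andbT !inE /=.
  by rewrite (perm_mem finsupp_star) mem_points.
split; rewrite count_star /= star_fsfunE /=.
  rewrite ltr0n r_gt0 count_map (eq_count (a2 := pred0)) ?count_pred0// => i /=.
  by rewrite star_fsfunE /= ltr0N1.
rewrite ltrn0 count_map (eq_count (a2 := predT)) ?count_predT ?size_enum_ord//.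
by move=> i /=; rewrite star_fsfunE /= ltrN10.
Qed.

(** The r(r-1) ordered pairs of distinct leaves contribute [2]^ q[each, and the 2r ordered
    center-leaf pairs contribute -r each. For r >= 2 the total is positive exactly when]2 [^ q]
    exceeds 2r/(r-1). *)
Lemma star_double_sum (q : R) : q != 0 ->
  \sum_(x <- finsupp star_fsfun) \sum_(y <- finsupp star_fsfun)
    star_fsfun x * star_fsfun y * mdist x y `^ q
  = r%:R * ((r%:R - 1) * 2 `^ q - 2 * r%:R).
Proof.
move=> q0; rewrite sum_star sum_star mdistxx powR0// mulr0 add0r.
have center (i : 'I_r) : mdist (Some i : star R r) None = 1 by [].
have leaf (i j : 'I_r) :
  mdist (Some i : star R r) (Some j) = if i == j then 0 else 2 by [].
have leaf_sum (i : 'I_r) : \sum_(y <- finsupp star_fsfun)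
    star_fsfun (Some i) * star_fsfun y * mdist (Some i : star R r) y `^ q
  = - r%:R + (r%:R - 1) * 2 `^ q.
  rewrite sum_star center powR1 mulr1 !star_fsfunE mulN1r; congr (_ + _).
  rewrite (bigD1 i) //= mdistxx powR0// mulr0 add0r.
  rewrite (eq_bigr (fun=> 2 `^ q)); last first.
    move=> j ji; rewrite !star_fsfunE mulrNN !mul1r.
    by rewrite leaf eq_sym (negPf ji).
  rewrite sumr_const -[LHS]mulr_natl (eq_card (B := predC1 i)) //.
  by rewrite cardC1 card_ord -subn1 natrB.
rewrite (eq_bigr _ (fun i _ => leaf_sum i)) sumr_const card_ord.
rewrite (eq_bigr (fun=> - r%:R)); last first.
  move=> i _; rewrite metric_sym center powR1 !star_fsfunE /=; ring.
rewrite sumr_const card_ord -[X in X + _]mulr_natl -[X in _ + X]mulr_natl.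
by ring.
Qed.

End StarSharpness.

Theorem theorem3p1 (R : realType) (r : nat) (r_ge2 : (2 <= r)%N) :
  [/\ (* the inequality under the condition on h_q = 2 ^ q - 2 *)
      forall (q : R) (X : metricType R) (c : {fsfun X -> R with 0}),
        1 <= q <= 2 -> zero_sum c -> has_sign_pattern 1 r c ->
        2 `^ q - 2 <= 2 / (r%:R - 1) -> negative_type_ineq q c,
      (* equivalence of the two conditions on q *)
      forall q : R, 1 <= q <= 2 ->
        (2 `^ q - 2 <= 2 / (r%:R - 1)) <->
        (q <= log2 (2 * r%:R / (r%:R - 1))),
      (* the equivalent form *)
      forall q : R, 1 <= q <= 2 -> q <= log2 (2 * r%:R / (r%:R - 1)) ->
        forall (X : metricType R) (c : {fsfun X -> R with 0}),
          zero_sum c -> has_sign_pattern 1 r c -> negative_type_ineq q c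
    & (* sharpness on the star *)
      sharp_exponent (star R r) 1 r (log2 (2 * r%:R / (r%:R - 1)))].
Proof.
have r2 : 2 <= r%:R :> R by rewrite ler_nat.
have r1 : 0 < r%:R - 1 :> R by lra.
have t0 : 0 < 2 * r%:R / (r%:R - 1) :> R by rewrite divr_gt0//; lra.
have tE : 2 * r%:R / (r%:R - 1) = 2 / (r%:R - 1) + 2 :> R.
  by field; rewrite gt_eqF.
have ineq (q : R) (X : metricType R) (c : {fsfun X -> R with 0}) :
    1 <= q <= 2 -> zero_sum c -> has_sign_pattern 1 r c ->
    2 `^ q - 2 <= 2 / (r%:R - 1) -> negative_type_ineq q c.
  by rewrite ler_pdivlMr//; exact: negative_type_one_positive.
have equiv (q : R) : (2 `^ q - 2 <= 2 / (r%:R - 1)) =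
    (q <= log2 (2 * r%:R / (r%:R - 1))).
  by rewrite ler_log2// tE lerBlDr.
split => //.
- by move=> q _; rewrite equiv.
- by move=> q q12; rewrite -equiv => hq X c c0 cs; exact: ineq.
- have r_gt0 : (0 < r)%N by exact: ltnW.
  move=> q ltq; exists (star_fsfun R r); split.
  + exact: zero_sum_star.
  + exact: star_sign_pattern.
  have q_gt0 : 0 < q.
    apply: le_lt_trans ltq; rewrite ler_log2// powRr0 tE.
    by rewrite ler_wpDl ?divr_ge0//; lra.
  rewrite /negative_type_ineq star_double_sum ?gt_eqF//; apply/negP.
  rewrite -ltNge mulr_gt0//; first lra.
  move: ltq; rewrite ltNge ler_log2// -ltNge ltr_pdivrMr//.
  by rewrite subr_gt0 [ltRHS]mulrC.
Qed.
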